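(* Let $k\in\mathbb N$. There exists a constant $c=c(k)>0$ such that the following holds: Let $d\in\mathbb N$, let $(H,\partial)$ be a group equipped with a bi-invariant metric, and let $G$ be a group of commutator width at most $k$. Then, for every $\varepsilon$, every unital uniform $\varepsilon$-polynomial map $\varphi\colon G\to H$ of degree $d$ is a uniform $c(k)^{d-1}\varepsilon$-homomorphism.
   Context: $\mathbb N=\{1,2,\dots\}$. A group $G$ has commutator width at most $k$ if every element of $G$ is a product of at most $k$ commutators (in particular $G$ is perfect). For $\varphi\colon G\to H$ and $g\in G$, $(\Delta_g\varphi)(h):=\varphi(gh)\varphi(h)^{-1}$, and $\Delta_{g_1,\dots,g_m}:=\Delta_{g_1}\circ\cdots\circ\Delta_{g_m}$. A map is unital if $\varphi(1)=1$. A unital map $\varphi\colon G\to H$ is a uniform $\varepsilon$-polynomial of degree $d$ if $\partial((\Delta_{g_1,\dots,g_{d+1}}\varphi)(1),1)\le\varepsilon$ for all $g_1,\dots,g_{d+1}\in G$. A uniform $\varepsilon$-homomorphism is a uniform $\varepsilon$-polynomial of degree one, equivalently $\partial(\varphi(gh),\varphi(g)\varphi(h))\le\varepsilon$ for all $g,h\in G$. *)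

(* Defs.v *)
From HB Require Import structures.
From mathcomp Require Import all_boot all_order all_algebra.
From mathcomp Require Import classical_sets filter reals topology.

Set Implicit Arguments.
Unset Strict Implicit.
Unset Printing Implicit Defensive.

Import Order.TTheory GRing.Theory Num.Theory.
Local Open Scope ring_scope.

HB.mixin Record Metric_isBiInvariant (R : numDomainType) H
    of Group H & Metric R H := {
  mdist_mull : forall a x y : H, mdist (a * x)%g (a * y)%g = mdist x y :> R ;
  mdist_mulr : forall a x y : H, mdist (x * a)%g (y * a)%g = mdist x y :> R
}.

#[short(type="biInvMetricGroupType")]
HB.structure Definition BiInvMetricGroup (R : numDomainType) :=
  {H of Group H & Metric R H & Metric_isBiInvariant R H}.

Definition commutator_width_le (G : groupType) (k : nat) : Prop :=
  forall g : G, exists2 s : seq (G * G),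
    (size s <= k)%N & g = (\prod_(p <- s) [~ p.1, p.2])%g.

Definition Delta (G H : groupType) (g : G) (phi : G -> H) : G -> H :=
  fun h => (phi (g * h) * (phi h)^-1)%g.

(* [Deltas [:: g_1; ...; g_m]] is Delta_{g_1} \o ... \o Delta_{g_m}:
   the last entry is applied first. *)
Definition Deltas (G H : groupType) (gs : seq G) (phi : G -> H) : G -> H :=
  foldr (@Delta G H) phi gs.

Definition unital (G H : groupType) (phi : G -> H) : Prop := phi 1%g = 1%g.

Definition uniform_polynomial (R : numDomainType) (G : groupType)
    (H : biInvMetricGroupType R) (eps : R) (d : nat) (phi : G -> H) : Prop :=
  unital phi /\
  forall gs : (d.+1).-tuple G, mdist (Deltas gs phi 1%g) 1%g <= eps.

Definition uniform_homomorphism (R : numDomainType) (G : groupType)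
    (H : biInvMetricGroupType R) (eps : R) (phi : G -> H) : Prop :=
  uniform_polynomial eps 1 phi.

(* For unital maps this is the usual approximate multiplicativity. *)
Lemma uniform_homomorphismP (R : numDomainType) (G : groupType)
    (H : biInvMetricGroupType R) (eps : R) (phi : G -> H) : unital phi ->
  uniform_homomorphism eps phi <->
  forall g h : G, mdist (phi (g * h)%g) (phi g * phi h)%g <= eps.
Proof.
move=> phi1.
have E (g h : G) : mdist (Deltas [:: g; h] phi 1%g) 1%g
    = mdist (phi (h * g)%g) (phi h * phi g)%g :> R.
  rewrite /= /Delta !mulg1 phi1 invg1 mulg1.
  by rewrite -(mdist_mulr (phi h * phi g)%g) mul1g mulgA mulgVK mulgVK.
split=> [[_ P] g h|P]; first by rewrite -E; exact: (P [tuple h; g]).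
by split=> // gs; case/tupleP: gs => g gs; case/tupleP: gs => h gs;
  rewrite tuple0 E.
Qed.

(* Main.v *)
(* Induction on d: a polynomial of degree d >= 2 is one of degree d - 1 at the
   cost of a factor 16 k. Every (d - 2)-fold difference w of phi, normalised to
   be unital, has a defect  a, b |-> w(ab) w(b)^-1 w(a)^-1  that is an
   eps-homomorphism in b. The cocycle identity writes the defect at ab as a
   conjugate of the product of the eps-homomorphisms given by a and by b, up to
   a further conjugation of the latter, so their values almost commute.
   Comparing a^-1 with a, for which the defect at a^-1 a is trivial, shows that
   each defect homomorphism has almost commuting values; hence it almost kills
   commutators, and therefore all of G. *)
Require Import Defs.
From mathcomp Require Import all_boot all_order all_algebra.
From mathcomp Require Import classical_sets filter reals topology.
From mathcomp Require Import lra.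

Import Order.TTheory GRing.Theory Num.Theory.
Local Open Scope ring_scope.

Section BiInvariantMetric.
Context {R : realFieldType} {H : biInvMetricGroupType R}.
Implicit Types (x y z a b : H) (e : R).

Lemma mdist_mul a b x y :
  mdist (a * x)%g (b * y)%g <= mdist a b + mdist x y :> R.
Proof.
apply: (le_trans (metric_triangle _ (b * x)%g _)).
by rewrite mdist_mulr mdist_mull.
Qed.

Lemma mdist_conj a x y :
  mdist (a * x * a^-1)%g (a * y * a^-1)%g = mdist x y :> R.
Proof. by rewrite mdist_mulr mdist_mull. Qed.

Lemma mdist_commuteV x y :
  mdist (x^-1 * y)%g (y * x^-1)%g = mdist (x * y)%g (y * x)%g :> R.
Proof.
(* Multiplying by [x] on both sides turns [x^-1 * y] into [y * x] and [y * x^-1] into [x * y]. *)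
rewrite -(mdist_mull x) -(mdist_mulr x) !mulgA mulgV mul1g mulgVK.
exact: metric_sym.
Qed.

End BiInvariantMetric.

Section ApproximateHomomorphism.
Context {R : realFieldType} {G : groupType} {H : biInvMetricGroupType R}.
Implicit Types (f g n : G -> H) (e : R).

Definition approx_mul e f :=
  forall x y : G, mdist (f (x * y)%g) (f x * f y)%g <= e.

(** Compare [n (x * y)] with [n x * n y] through the conjugated products: once [c], [f x] and [g y]
    cancel, only the order of [f y] and [g x] differs. The six errors are three from the hypothesis
    on [n h] and one each for [f], [g], [n]. *)
Lemma approx_mul_commute e f g n (c : H) :
  approx_mul e f -> approx_mul e g -> approx_mul e n ->
  (forall h, mdist (n h) (c * (f h * g h) * c^-1)%g <= e) ->
  forall x y, mdist (f y * g x)%g (g x * f y)%g <= e *+ 6.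
Proof.
move=> Hf Hg Hn E x y.
have := E (x * y)%g; have := mdist_mul (n x) (c * (f x * g x) * c^-1)%g
  (n y) (c * (f y * g y) * c^-1)%g.
rewrite !mulgA mulgVK -!mulgA.
have := E x; have := E y; have := Hn x y.
have := mdist_mul (f (x * y)%g) (f x * f y)%g (g (x * y)%g) (g x * g y)%g.
have := Hf x y; have := Hg x y.
rewrite -(mdist_conj c (f (x * y)%g * g (x * y)%g)%g) !mulgA.
set p := (c * f x * f y * g x * g y * c^-1)%g.
set q := (c * f x * g x * f y * g y * c^-1)%g.
have <- : mdist p q = mdist (f y * g x)%g (g x * f y)%g :> R.
  by rewrite !mdist_mulr -!mulgA !mdist_mull.
set u := n (x * y)%g; set v := (c * _ * _ * _)%g; set w := (n x * n y)%g.
have := metric_triangle p v q; have := metric_triangle v u q.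
have := metric_triangle u w q; rewrite (metric_sym v u) (metric_sym p v).
lra.
Qed.

(** Since [x * y = y * x * [~ x, y]], the value at the commutator measures how far [f (x * y)] is
    from [f (y * x)]; three product estimates join the 12. *)
Lemma approx_mul_commutator e f (x y : G) : approx_mul e f ->
  mdist (f x * f y)%g (f y * f x)%g <= e *+ 12 ->
  mdist (f [~ x, y]%g) 1%g <= e *+ 15.
Proof.
move=> Hf C; have := Hf (y * x)%g [~ x, y]%g; rewrite -commgC.
rewrite -(mdist_mull (f (y * x)%g) (f [~ x, y]%g)) mulg1.
move: C (Hf x y) (Hf y x).
set p := (f x * f y)%g; set q := (f y * f x)%g; set r := (_ * f [~ x, y])%g.
set u := f (x * y)%g; set v := f (y * x)%g.
have := metric_triangle r u v; have := metric_triangle u p v.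
have := metric_triangle p q v; rewrite (metric_sym r u) (metric_sym q v).
lra.
Qed.

Lemma approx_mul_width e f (k : nat) : commutator_width_le G k ->
  0 <= e -> f 1%g = 1%g -> approx_mul e f ->
  (forall x y, mdist (f x * f y)%g (f y * f x)%g <= e *+ 12) ->
  forall g : G, mdist (f g) 1%g <= (16 * k)%:R * e.
Proof.
move=> W e0 f1 Hf C g; have [s sk ->] := W g.
apply: (@le_trans _ _ ((16 * size s)%:R * e)); last first.
  by rewrite ler_wpM2r // ler_nat leq_mul2l.
elim: s {sk} => [|[x y] s IH]; first by rewrite big_nil f1 mdistxx muln0 mul0r.
(* Each commutator costs 15 for its value and 1 for splitting it off, hence 16. *)
rewrite big_cons /=; set p := (\prod_(_ <- s) _)%g in IH *.
have := mdist_mul (f [~ x, y]%g) 1%g (f p) 1%g; rewrite mulg1.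
have := approx_mul_commutator _ _ _ _ Hf (C x y); have := Hf [~ x, y]%g p.
have := metric_triangle (f ([~ x, y] * p)%g) (f [~ x, y] * f p)%g 1%g.
rewrite mulnS natrD mulrDl.
lra.
Qed.

End ApproximateHomomorphism.

Section Defect.
Context {R : realFieldType} {G : groupType} {H : biInvMetricGroupType R}.
Variables (w : G -> H) (e : R).
Hypothesis w1 : w 1%g = 1%g.

Definition defect (a b : G) : H := (w (a * b)%g * (w b)^-1 * (w a)^-1)%g.

Hypothesis Hdefect : forall a, approx_mul e (defect a).

Lemma defectg1 a : defect a 1%g = 1%g.
Proof. by rewrite /defect w1 mulg1 invg1 mulg1 mulgV. Qed.

Lemma defect1g a : defect 1%g a = 1%g.
Proof. by rewrite /defect w1 mul1g invg1 mulg1 mulgV. Qed.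

Lemma defect_cocycle a b h :
  defect (a * b)%g h =
  (defect a (b * h) * (w a * defect b h * (w a)^-1) * (defect a b)^-1)%g.
Proof. by rewrite /defect !invgM !invgK !mulgA !mulgVK. Qed.

Lemma defect_commute_conj a b x y :
  let g := (w a * defect b x * (w a)^-1)%g in
  mdist (defect a y * g)%g (g * defect a y)%g <= e *+ 6.
Proof.
pose g h := (w a * defect b h * (w a)^-1)%g.
apply: (approx_mul_commute e _ g (defect (a * b)%g) (defect a b)) => //.
  move=> u v; have := Hdefect b u v; rewrite -(mdist_conj (w a)) /g.
  by rewrite !mulgA mulgVK.
(* Splitting [defect a (b * h)] at cost [e] makes [defect a b] the conjugator. *)
move=> h; rewrite defect_cocycle mdist_mulr (mulgA (defect a b)) mdist_mulr.
exact: Hdefect.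
Qed.

Lemma defect_commute a x y :
  mdist (defect a x * defect a y)%g (defect a y * defect a x)%g <= e *+ 12.
Proof.
pose g h := (w a^-1 * defect a h * (w a^-1)^-1)%g.
(* The cocycle identity at [a^-1 * a = 1] has a trivial left side. It expresses [g x] by two values
   of [defect a^-1], each commuting with [g y] up to 6 errors, which gives 12. *)
have gE : g x = ((defect a^-1 (a * x))^-1 * defect a^-1 a)%g.
  have := defect_cocycle a^-1%g a x; rewrite mulVg defect1g => E.
  apply: (mulgI (defect a^-1 (a * x))%g).
  by apply: (mulIg (defect a^-1 a)^-1%g); rewrite -E mulVKg mulgV.
rewrite -(mdist_conj (w a^-1%g)).
have gM u v :
    (w a^-1 * (defect a u * defect a v) * (w a^-1)^-1 = g u * g v)%g.
  by rewrite /g !mulgA mulgVK.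
have := defect_commute_conj a^-1%g a y (a * x)%g.
have := defect_commute_conj a^-1%g a y a; rewrite !gM gE /= -/(g y).
move: (g y) (defect _ (a * x)%g) (defect _ a) => b q r.
rewrite -(mdist_commuteV q) -(mdist_mulr r (q^-1 * _)%g).
rewrite -(mdist_mull (q^-1)%g (r * _)%g) !mulgA.
have := metric_triangle (q^-1 * r * b)%g (q^-1 * b * r)%g (b * q^-1 * r)%g.
lra.
Qed.

End Defect.

Section DegreeReduction.
Context {R : realFieldType} {G : groupType} {H : biInvMetricGroupType R}.
Variables (k : nat) (e : R).
Hypothesis W : commutator_width_le G k.

Lemma Deltas3_to_Deltas2 (f : G -> H) :
  (forall x y a, mdist (Deltas [:: x; y; a] f 1%g) 1%g <= e) ->
  forall x a, mdist (Deltas [:: x; a] f 1%g) 1%g <= (16 * k)%:R * e.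
Proof.
move=> P x a; have e0 : 0 <= e by exact: le_trans (mdist_ge0 _ _) (P x x x).
pose w h := (f h * (f 1)^-1)%g.
have w1 : w 1%g = 1%g by exact: mulgV.
have D b c : defect w b c = Deltas [:: c; b] f 1%g.
  by rewrite /defect /w /= /Delta !mulg1 !invgM !invgK !mulgA mulgVK.
have Hw b : approx_mul e (defect w b).
  (* The third difference is exactly [defect w b (y * z)] times the inverse of
     [defect w b y * defect w b z]. *)
  move=> y z; apply: le_trans (P z y b).
  rewrite le_eqVlt; apply/orP; left; apply/eqP.
  rewrite !D -(mdist_mulr (Deltas [:: y; b] f 1 * Deltas [:: z; b] f 1)%g
    (Deltas [:: z; y; b] f 1)%g) mul1g /= /Delta !mulg1 !invgM !invgK.
  by rewrite !mulgA !(mulgVK, mulgK).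
rewrite -D; apply: approx_mul_width => //; first exact: defectg1.
exact: defect_commute.
Qed.

Lemma uniform_polynomial_pred (d : nat) (phi : G -> H) :
  uniform_polynomial e d.+2 phi ->
  uniform_polynomial ((16 * k)%:R * e) d.+1 phi.
Proof.
move=> [phi1 P]; split=> // gs.
case/tupleP: gs => x gs; case/tupleP: gs => a gs.
(* The trailing entries act first, so they are frozen into one map, in general not unital. *)
apply: (Deltas3_to_Deltas2 (Deltas gs phi)) => y z b.
exact: (P [tuple of [:: y, z, b & gs]]).
Qed.

End DegreeReduction.

Theorem theorem1p7 (R : realType) (k : nat) (hk : (0 < k)%N) :
  exists2 c : R, 0 < c &
    forall (d : nat) (hd : (0 < d)%N)
      (H : biInvMetricGroupType R) (G : groupType)
      (hG : commutator_width_le G k) (eps : R) (phi : G -> H),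
      uniform_polynomial eps d phi ->
      uniform_homomorphism (c ^+ d.-1 * eps) phi.
Proof.
exists (16 * k)%:R; first by rewrite ltr0n muln_gt0.
case=> // d _ H G W eps phi /=.
(* [eps] stays general because each drop in degree multiplies it by [16 * k]. *)
elim: d eps => [|d IH] eps P; first by rewrite expr0 mul1r.
by rewrite exprSr -mulrA; apply: IH; exact: uniform_polynomial_pred.
Qed.
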